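(* Let $\mathbf B$ be an injective involutive bisemilattice with Booleanisation $\mathbf A_\infty$. Then the map $\Phi$, sending a state $s$ over $\mathbf B$ to the finitely additive probability measure $\Phi(s)$ on $\mathbf A_\infty$ given by $\Phi(s)([b]_\sim)=s(b)$, restricts to a bijection between the faithful states over $\mathbf B$ and the regular finitely additive probability measures on $\mathbf A_\infty$.
   Context: An involutive bisemilattice is an algebra $\mathbf B=\langle B,\wedge,\vee,',0,1\rangle$ of type $(2,2,1,0,0)$ satisfying $x\vee x\approx x$, $x\vee y\approx y\vee x$, $x\vee(y\vee z)\approx(x\vee y)\vee z$, $(x')'\approx x$, $x\wedge y\approx(x'\vee y')'$, $x\wedge(x'\vee y)\approx x\wedge y$, $0\vee x\approx x$, $1\approx 0'$. Every involutive bisemilattice is (canonically) the Płonka sum of a semilattice direct system of Boolean algebras, and $\mathbf B$ is identified with it: a join-semilattice $(I,\vee)$ with least element $i_0$, Boolean algebras $\mathbf A_i$ with pairwise disjoint universes, Boolean homomorphisms $p_{ij}\colon\mathbf A_i\to\mathbf A_j$ ($i\le j$) with $p_{ii}=\mathrm{id}$, $p_{ik}=p_{jk}\circ p_{ij}$; $B=\bigsqcup_iA_i$; for $a\in A_i$, $b\in A_j$, $k=i\vee j$: $a\wedge b=p_{ik}(a)\wedge^{\mathbf A_k}p_{jk}(b)$, $a\vee b=p_{ik}(a)\vee^{\mathbf A_k}p_{jk}(b)$; $a'$ computed in the algebra containing $a$; $0,1$ those of $\mathbf A_{i_0}$. $0_i,1_i$ are bottom and top of $\mathbf A_i$. $\mathbf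 B$ is injective if every $p_{ij}$ is injective. A state is a map $s\colon B\to[0,1]$ with $s(1)=1$ and $s(a\vee b)=s(a)+s(b)$ whenever $a\wedge b\in\{0_i:i\in I\}$; it is faithful if $s(a)>0$ for every $a\in B\setminus\{0_i:i\in I\}$. A finitely additive probability measure $m$ on a Boolean algebra ($m(1)=1$, $m(a\vee b)=m(a)+m(b)$ when $a\wedge b=0$) is regular if $m(a)>0$ for all $a\ne0$. Booleanisation: $a\sim b$ (for $a\in A_i,b\in A_j$) iff $p_{ik}(a)=p_{jk}(b)$ for some $k\ge i,j$; $\mathbf A_\infty=B/{\sim}$ is the direct limit Boolean algebra. ($\Phi(s)$ is well defined and is a finitely additive probability measure for every state $s$.) *)

(* Defs.v *)
From HB Require Import structures.
From mathcomp Require Import all_boot all_order all_algebra.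
From mathcomp Require Import boolp classical_sets functions reals.
From mathcomp Require Import generic_quotient.

Set Implicit Arguments.
Unset Strict Implicit.
Unset Printing Implicit Defensive.

Import Order.TTheory GRing.Theory Num.Theory.

Declare Scope ibsl_scope.
Delimit Scope ibsl_scope with ibsl.
Local Open Scope ibsl_scope.

Reserved Notation "x \wedge y" (at level 40, left associativity).
Reserved Notation "x \vee y" (at level 50, left associativity).

(* With the classical axioms of boolp every type is a choice type, so Choice
   is no restriction on the carrier. *)
HB.mixin Record isInvBisemilattice T of Choice T := {
  imeet : T -> T -> T;
  ijoin : T -> T -> T;
  ineg : T -> T;
  izero : T;
  ione : T;
  ijoinxx : forall x, ijoin x x = x;
  ijoinC : forall x y, ijoin x y = ijoin y x;
  ijoinA : forall x y z, ijoin x (ijoin y z) = ijoin (ijoin x y) z;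
  inegK : forall x, ineg (ineg x) = x;
  imeetE : forall x y, imeet x y = ineg (ijoin (ineg x) (ineg y));
  imeetNU : forall x y, imeet x (ijoin (ineg x) y) = imeet x y;
  ijoin0x : forall x, ijoin izero x = x;
  ioneE : ione = ineg izero
}.

#[short(type="ibslType")]
HB.structure Definition InvBisemilattice :=
  { T of isInvBisemilattice T & Choice T }.

Notation "x \wedge y" := (imeet x y) : ibsl_scope.
Notation "x \vee y" := (ijoin x y) : ibsl_scope.

Section IbslTheory.
Variable B : ibslType.
Implicit Types a x y z p q t w : B.

Lemma inegU x y : ineg (x \vee y) = ineg x \wedge ineg y.
Proof. by rewrite imeetE !inegK. Qed.
Lemma inegI x y : ineg (x \wedge y) = ineg x \vee ineg y.
Proof. by rewrite imeetE inegK. Qed.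
Lemma ineg_inj : injective (@ineg B).
Proof. exact: can_inj inegK. Qed.
Lemma ineg0 : ineg (izero : B) = ione. Proof. by rewrite ioneE. Qed.
Lemma ineg1 : ineg (ione : B) = izero. Proof. by rewrite ioneE inegK. Qed.

Lemma imeetxx x : x \wedge x = x.
Proof. by rewrite imeetE ijoinxx inegK. Qed.
Lemma imeetC x y : x \wedge y = y \wedge x.
Proof. by rewrite !imeetE ijoinC. Qed.
Lemma imeetA x y z : x \wedge (y \wedge z) = x \wedge y \wedge z.
Proof. by rewrite !imeetE !inegK ijoinA. Qed.
Lemma imeetAC x y z : x \wedge y \wedge z = x \wedge z \wedge y.
Proof. by rewrite -!imeetA (imeetC y). Qed.
Lemma ijoinAC x y z : x \vee y \vee z = x \vee z \vee y.
Proof. by rewrite -!ijoinA (ijoinC y). Qed.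
Lemma ijoinACA x y p q : x \vee y \vee (p \vee q) = x \vee p \vee (y \vee q).
Proof. by rewrite !ijoinA (ijoinAC x y). Qed.
Lemma ijoinNI x y : x \vee (ineg x \wedge y) = x \vee y.
Proof. by apply: ineg_inj; rewrite !inegU inegI imeetNU. Qed.
Lemma ijoinx0 x : x \vee izero = x. Proof. by rewrite ijoinC ijoin0x. Qed.
Lemma imeet1x x : ione \wedge x = x.
Proof. by apply: ineg_inj; rewrite inegI ineg1 ijoin0x. Qed.

(* [x \wedge ineg x] is the bottom of the summand containing x. *)
Definition iloc x := x \wedge ineg x.

Lemma iloc0 x : iloc x = x \wedge izero.
Proof. by rewrite /iloc -[ineg x]ijoinx0 imeetNU. Qed.
Lemma ilocN x : iloc (ineg x) = iloc x.
Proof. by rewrite /iloc inegK imeetC. Qed.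
Lemma ilocI x y : iloc (x \wedge y) = iloc x \wedge iloc y.
Proof.
by rewrite !iloc0 imeetA [x \wedge izero \wedge y]imeetAC -[RHS]imeetA imeetxx.
Qed.
Lemma ilocU x y : iloc (x \vee y) = iloc x \wedge iloc y.
Proof. by rewrite -ilocN inegU ilocI !ilocN. Qed.
Lemma ilocK x : iloc (iloc x) = iloc x.
Proof. by rewrite !iloc0 -imeetA imeetxx. Qed.
Lemma ijoin_loc x : x \vee iloc x = x.
Proof. by rewrite /iloc imeetC ijoinNI ijoinxx. Qed.

Lemma ijoin_under x p : iloc p = p -> x \vee p = x \vee (iloc x \wedge p).
Proof.
move=> hp; rewrite -ijoinNI -(ilocN x) iloc0 -imeetA.
by rewrite (imeetC izero) -iloc0 hp.
Qed.

Lemma locU_I p q : iloc p = p -> iloc q = q -> p \vee q = p \wedge q.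
Proof.
move=> hp hq; rewrite [LHS]ijoin_under // hp ijoinC ijoin_under //.
by rewrite ilocI hp hq imeetAC imeetxx ijoinxx.
Qed.

Lemma ilocUU x y : iloc (x \vee y) = iloc x \vee iloc y.
Proof. by rewrite ilocU locU_I ?ilocK. Qed.
Lemma ilocIU x y : iloc (x \wedge y) = iloc x \vee iloc y.
Proof. by rewrite ilocI locU_I ?ilocK. Qed.

Lemma ineg_loc x : ineg (iloc x) = x \vee ineg x.
Proof. by rewrite /iloc inegI inegK ijoinC. Qed.

Lemma imeetKU_loc x y : iloc x = iloc y -> x \wedge (x \vee y) = x.
Proof.
move=> e; rewrite -imeetNU ijoinA (ijoinC (ineg x)) -ineg_loc.
suff -> : ineg (iloc x) \vee y = ineg x \vee x.
  by rewrite imeetNU imeetxx.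
rewrite e ijoinC ineg_loc ijoinA ijoinxx -ineg_loc -e ineg_loc.
exact: ijoinC.
Qed.

Lemma ijoinKI_loc x y : iloc x = iloc y -> x \vee (x \wedge y) = x.
Proof.
move=> e; apply: ineg_inj; rewrite inegU inegI imeetKU_loc //.
by rewrite !ilocN.
Qed.

Lemma imeetUl_loc x y z : iloc x = iloc y -> iloc z = iloc y ->
  z \wedge (x \vee y) = (z \wedge x) \vee (z \wedge y).
Proof.
move=> ex ez.
have [w wE] : exists w, w = (z \wedge x) \vee (z \wedge y) by eexists.
rewrite -wE; have lw : iloc w = iloc y by rewrite wE ilocU !ilocI ez ex !imeetxx.
have ub t : (t == x) || (t == y) -> ineg z \vee w \vee t = ineg z \vee w.
  move=> ht; have tw : (z \wedge t) \vee w = w.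
    case/orP: ht => /eqP ->; rewrite wE ?ijoinA ?ijoinxx //.
    by rewrite ijoinAC ijoinxx ijoinC.
  rewrite -[in RHS]tw [RHS]ijoinA.
  have := ijoinNI (ineg z) t; rewrite inegK => ->.
  exact: ijoinAC.
have U1 : ineg z \vee w \vee (x \vee y) = ineg z \vee w.
  by rewrite ijoinA !ub ?eqxx ?orbT.
have le1 : (x \vee y) \wedge (ineg z \vee w) = x \vee y.
  rewrite -U1 (ijoinC (ineg z \vee w)) imeetKU_loc // !ilocU lw ilocN ex ez.
  by rewrite !imeetxx.
have M1 : z \wedge (x \vee y) \wedge w = z \wedge (x \vee y).
  by rewrite -[in RHS]le1 [RHS]imeetA [RHS]imeetAC imeetNU imeetAC.
have le2 : z \wedge (x \vee y) \vee w = z \wedge (x \vee y).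
  have K t : (t == x) || (t == y) ->
      z \wedge (x \vee y) \vee (z \wedge t) = z \wedge (x \vee y).
    move=> ht; have tE : z \wedge t = z \wedge (x \vee y) \wedge (z \wedge t).
      rewrite imeetA [z \wedge _ \wedge z]imeetAC imeetxx -imeetA.
      congr (_ \wedge _); rewrite imeetC.
      case/orP: ht => /eqP ->; first by rewrite imeetKU_loc.
      by rewrite ijoinC imeetKU_loc.
    rewrite tE ijoinKI_loc // !ilocI !ilocU ez ex.
    by case/orP: ht => /eqP ->; rewrite ?ex !imeetxx.
  by rewrite wE ijoinA !K ?eqxx ?orbT.
rewrite -[LHS]le2 ijoinC -M1 imeetC ijoinKI_loc //.
by rewrite ilocI ilocU lw ez ex !imeetxx.
Qed.

Lemma iloc_shift a q : iloc q = q -> iloc (a \vee q) = iloc a \vee q.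
Proof. by move=> h; rewrite ilocUU h. Qed.

Lemma ijoin_shift a w q : w \vee q = w -> ineg w \vee q = ineg w ->
  a \wedge w = (a \vee q) \wedge w.
Proof.
move=> h h'; rewrite (imeetC a) (imeetC (a \vee q)).
by rewrite -[LHS]imeetNU -[RHS]imeetNU (ijoinC a q) ijoinA h'.
Qed.

Lemma ineg_shift a q : iloc q = q -> iloc a \vee q = q ->
  ineg (a \vee q) = ineg a \vee q.
Proof.
move=> hq haq.
have la : iloc (a \vee q) = q by rewrite iloc_shift.
have lna : iloc (ineg a \vee q) = q by rewrite iloc_shift // ilocN.
have sq t : iloc t = q -> t \vee q = t by move=> <-; exact: ijoin_loc.
have M : (a \vee q) \wedge (ineg a \vee q) = q.
  rewrite -ijoin_shift; last first.
  - by apply: sq; rewrite ilocN.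
  - exact: sq.
  by rewrite imeetNU -{1}hq iloc0 (imeetC q) imeetA -iloc0 -locU_I ?ilocK.
have J : (a \vee q) \vee (ineg a \vee q) = ineg q.
  have -> : (a \vee q) \vee (ineg a \vee q) = ineg (iloc a) \vee q.
    by rewrite ineg_loc ijoinA (ijoinAC a q) -[LHS]ijoinA ijoinxx.
  apply: ineg_inj; rewrite inegU !inegK imeetC -imeetNU inegK.
  by rewrite (ijoinC q) haq imeetC.
move: (a \vee q) (ineg a \vee q) la lna M J => u v lu lv M J.
have E1 : ineg u = ineg u \wedge v.
  rewrite -imeetNU inegK J -lu ineg_loc (ijoinC u) imeetKU_loc //.
  exact: ilocN.
have E2 : v = ineg u \wedge v.
  have lNv : iloc v = iloc (ineg v) by rewrite ilocN.
  rewrite -{1}(imeetKU_loc lNv) -ineg_loc lv -lu ineg_loc.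
  rewrite imeetUl_loc ?ilocN ?lu ?lv // (imeetC v u) M ijoinC (imeetC v).
  by rewrite sq // ilocI ilocN lu lv imeetxx.
by rewrite E1 -E2.
Qed.

End IbslTheory.

(* In a Plonka sum, the elements x with x \wedge x' = x are exactly the
   bottoms 0_i of the summands; moreover x \wedge x' = 0_i iff x lies in A_i,
   i <= j iff 0_i \vee 0_j = 0_j, and p_ij(a) = a \vee 0_j.  Hence the system
   whose Plonka sum is B is recovered inside B, with the 0_i as indices. *)

Fact index_display : Order.disp_t. Proof. exact: Order.Disp tt tt. Qed.
Fact fibre_display : Order.disp_t. Proof. exact: Order.Disp tt tt. Qed.
Fact bool_display : Order.disp_t. Proof. exact: Order.Disp tt tt. Qed.

Record ib_index (B : ibslType) :=
  Index { index_val : B; _ : iloc index_val == index_val }.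

Section Index.
Variable B : ibslType.
Local Notation I := (ib_index B).
Implicit Types i j k : I.

HB.instance Definition _ := [isSub for @index_val B].
HB.instance Definition _ := [Choice of I by <:].

Lemma indexP i : iloc (val i) = val i. Proof. exact/eqP/(valP i). Qed.

Definition index_le i j := val i \vee val j == val j.

Fact index_le_refl : reflexive index_le.
Proof. by move=> i; rewrite /index_le ijoinxx. Qed.
Fact index_le_anti : antisymmetric index_le.
Proof.
move=> i j /andP[/eqP ij /eqP ji]; apply: val_inj.
by rewrite -ji ijoinC.
Qed.
Fact index_le_trans : transitive index_le.
Proof.
by move=> j i k /eqP ij /eqP jk; rewrite /index_le -jk ijoinA ij.
Qed.

HB.instance Definition _ := Order.Le_isPOrder.Build index_display I
  index_le_refl index_le_anti index_le_trans.

Fact index_joinP i j : iloc (val i \vee val j) == val i \vee val j.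
Proof. by rewrite ilocUU !indexP. Qed.
Definition index_join i j : I := Index (index_joinP i j).

Fact index_joinC : commutative index_join.
Proof. by move=> i j; apply: val_inj; exact: ijoinC. Qed.
Fact index_joinA : associative index_join.
Proof. by move=> i j k; apply: val_inj; exact: ijoinA. Qed.
Fact index_leEjoin i j : (j <= i)%O = (index_join i j == i).
Proof. by rewrite -val_eqE /= ijoinC. Qed.

HB.instance Definition _ := Order.POrder_Join_isSemilattice.Build
  index_display I index_joinC index_joinA index_leEjoin.

Fact index_botP : iloc (izero : B) == izero.
Proof. by rewrite iloc0 imeetxx. Qed.
Definition index_bot : I := Index index_botP.
Fact index_le0x i : (index_bot <= i)%O.
Proof. by apply/eqP; exact: ijoin0x. Qed.

HB.instance Definition _ :=
  Order.hasBottom.Build index_display I index_le0x.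

Fact locP (x : B) : iloc (iloc x) == iloc x. Proof. by rewrite ilocK. Qed.
Definition loc (x : B) : I := Index (locP x).

Lemma index_leP i j : reflect (val i \vee val j = val j) (i <= j)%O.
Proof. exact: eqP. Qed.

End Index.

Record fibre (B : ibslType) (i : ib_index B) :=
  Fibre { fibre_val : B; _ : loc fibre_val == i }.

Section Fibre.
Variables (B : ibslType) (i : ib_index B).
Local Notation A := (fibre i).
Implicit Types a b c : A.

HB.instance Definition _ := [isSub for @fibre_val B i].
HB.instance Definition _ := [Choice of A by <:].

Lemma fibreP a : iloc (val a) = val i.
Proof. by case: a => x /= /eqP <-. Qed.
Lemma fibreI (x : B) : iloc x = val i -> loc x == i.
Proof. by move=> h; apply/eqP/val_inj. Qed.

Fact fibre_meetP a b : loc (val a \wedge val b) == i.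
Proof. by apply: fibreI; rewrite ilocI !fibreP imeetxx. Qed.
Fact fibre_joinP a b : loc (val a \vee val b) == i.
Proof. by apply: fibreI; rewrite ilocU !fibreP imeetxx. Qed.
Fact fibre_complP a : loc (ineg (val a)) == i.
Proof. by apply: fibreI; rewrite ilocN fibreP. Qed.
Fact fibre_botP : loc (val i) == i.
Proof. by apply: fibreI; rewrite indexP. Qed.
Fact fibre_topP : loc (ineg (val i)) == i.
Proof. by apply: fibreI; rewrite ilocN indexP. Qed.

Definition fibre_meet a b : A := Fibre (fibre_meetP a b).
Definition fibre_join a b : A := Fibre (fibre_joinP a b).
Definition fibre_compl a : A := Fibre (fibre_complP a).
Definition fibre_bot : A := Fibre fibre_botP.
Definition fibre_top : A := Fibre fibre_topP.

Fact fibre_meetC : commutative fibre_meet.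
Proof. by move=> a b; apply: val_inj; exact: imeetC. Qed.
Fact fibre_joinC : commutative fibre_join.
Proof. by move=> a b; apply: val_inj; exact: ijoinC. Qed.
Fact fibre_meetA : associative fibre_meet.
Proof. by move=> a b c; apply: val_inj; exact: imeetA. Qed.
Fact fibre_joinA : associative fibre_join.
Proof. by move=> a b c; apply: val_inj; exact: ijoinA. Qed.
Fact fibre_joinKI b a : fibre_meet a (fibre_join a b) = a.
Proof. by apply: val_inj; apply: imeetKU_loc; rewrite !fibreP. Qed.
Fact fibre_meetKU b a : fibre_join a (fibre_meet a b) = a.
Proof. by apply: val_inj; apply: ijoinKI_loc; rewrite !fibreP. Qed.
Fact fibre_meetUl : left_distributive fibre_meet fibre_join.
Proof.
move=> a b c; rewrite !(fibre_meetC _ c); apply: val_inj.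
by apply: imeetUl_loc; rewrite !fibreP.
Qed.
Fact fibre_meetxx : idempotent_op fibre_meet.
Proof. by move=> a; apply: val_inj; exact: imeetxx. Qed.

HB.instance Definition _ := Order.isMeetJoinDistrLattice.Build
  fibre_display A (fun _ _ => erefl) (fun _ _ => erefl)
  fibre_meetC fibre_joinC fibre_meetA fibre_joinA fibre_joinKI fibre_meetKU
  fibre_meetUl fibre_meetxx.

Fact fibre_le0x a : (fibre_bot <= a)%O.
Proof.
apply/eqP/val_inj; rewrite /= -(fibreP a) /iloc.
by rewrite imeetAC imeetxx.
Qed.
Fact fibre_lex1 a : (a <= fibre_top)%O.
Proof.
apply/eqP/val_inj; rewrite /= -(fibreP a) ineg_loc.
by rewrite imeetKU_loc ?ilocN.
Qed.

HB.instance Definition _ := Order.hasBottom.Build fibre_display A fibre_le0x.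
HB.instance Definition _ := Order.hasTop.Build fibre_display A fibre_lex1.

Fact fibre_joinxC a : (a `|` fibre_compl a)%O = \top%O.
Proof. by apply: val_inj; rewrite /= -ineg_loc fibreP. Qed.
Fact fibre_meetxC a : (a `&` fibre_compl a)%O = \bot%O.
Proof. by apply: val_inj; exact: fibreP. Qed.

HB.instance Definition _ := Order.TBDistrLattice_hasComplement.Build
  fibre_display A fibre_joinxC fibre_meetxC.

End Fibre.

Section FibreMap.
Variable B : ibslType.
Implicit Types i j k : ib_index B.

Fact fibre_mapP i j (ij : (i <= j)%O) (a : fibre i) :
  loc (val a \vee val j) == j.
Proof.
by apply: fibreI; rewrite ilocUU fibreP indexP; apply/index_leP.
Qed.

Definition fibre_map i j (ij : (i <= j)%O) (a : fibre i) : fibre j :=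
  Fibre (fibre_mapP ij a).

Definition in_fibre (x : B) : fibre (loc x) := Fibre (eqxx (loc x)).

End FibreMap.

Definition boolean_hom d d' (A : ctbDistrLatticeType d)
    (A' : ctbDistrLatticeType d') (f : A -> A') : Prop :=
  [/\ forall a b, f (a `&` b)%O = (f a `&` f b)%O,
      forall a b, f (a `|` b)%O = (f a `|` f b)%O,
      forall a, f (~` a)%O = (~` f a)%O,
      f \bot%O = \bot%O
    & f \top%O = \top%O].

Record boolean_system d d' := BooleanSystem {
  bs_index : bJoinSemilatticeType d;
  bs_alg : bs_index -> ctbDistrLatticeType d';
  bs_map : forall i j : bs_index, (i <= j)%O -> bs_alg i -> bs_alg j;
  bs_map_hom : forall i j (ij : (i <= j)%O), boolean_hom (bs_map ij);
  bs_map_id : forall i (ii : (i <= i)%O) a, bs_map ii a = a;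
  bs_map_comp : forall i j k (ij : (i <= j)%O) (jk : (j <= k)%O)
    (ik : (i <= k)%O) a, bs_map ik a = bs_map jk (bs_map ij a)
}.

Section PlonkaSum.
Variables (d d' : Order.disp_t) (S : boolean_system d d').
Local Notation A := (@bs_alg _ _ S).

Definition plonka_sum := {i : bs_index S & A i}.
Implicit Types u v : plonka_sum.

Definition plonka_meet u v : plonka_sum :=
  Tagged A (bs_map (leUl (tag u) (tag v)) (tagged u)
            `&` bs_map (leUr (tag v) (tag u)) (tagged v))%O.
Definition plonka_join u v : plonka_sum :=
  Tagged A (bs_map (leUl (tag u) (tag v)) (tagged u)
            `|` bs_map (leUr (tag v) (tag u)) (tagged v))%O.
Definition plonka_neg u : plonka_sum := Tagged A (~` tagged u)%O.
Definition plonka_zero : plonka_sum := Tagged A (\bot%O : A \bot%O).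
Definition plonka_one : plonka_sum := Tagged A (\top%O : A \bot%O).

Definition injective_system : Prop :=
  forall (i j : bs_index S) (ij : (i <= j)%O), injective (bs_map ij).

End PlonkaSum.

Section CanonicalSystem.
Variable B : ibslType.
Implicit Types i j k : ib_index B.

Lemma imeet_shift (x y q : B) : iloc q = q -> iloc x \vee q = q ->
  iloc y \vee q = q -> (x \wedge y) \vee q = (x \vee q) \wedge (y \vee q).
Proof.
move=> hq hx hy; apply: ineg_inj.
rewrite ineg_shift //; last by rewrite ilocIU -ijoinA hy.
rewrite !inegI !ineg_shift // ijoinA (ijoinAC _ q).
by rewrite -[RHS]ijoinA ijoinxx.
Qed.

Fact fibre_map_hom i j (ij : (i <= j)%O) : boolean_hom (fibre_map ij).
Proof.
have hj := indexP j; have := ij => /index_leP h.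
split=> [a b|a b|a||]; apply: val_inj => /=.
- by rewrite imeet_shift // fibreP.
- by rewrite ijoinA (ijoinAC _ (val j)) -[RHS]ijoinA ijoinxx.
- by rewrite ineg_shift // fibreP.
- exact: h.
- by rewrite -ineg_shift ?indexP // h.
Qed.

Fact fibre_map_id i (ii : (i <= i)%O) (a : fibre i) : fibre_map ii a = a.
Proof. by apply: val_inj; rewrite /= -(fibreP a) ijoin_loc. Qed.

Fact fibre_map_comp i j k (ij : (i <= j)%O) (jk : (j <= k)%O)
    (ik : (i <= k)%O) (a : fibre i) :
  fibre_map ik a = fibre_map jk (fibre_map ij a).
Proof.
apply: val_inj; rewrite /= -ijoinA.
by have /index_leP -> := jk.
Qed.

Definition canonical_system : boolean_system index_display fibre_display :=
  @BooleanSystem _ _ (ib_index B) (@fibre B) (@fibre_map B)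
    fibre_map_hom fibre_map_id fibre_map_comp.

Definition to_plonka (x : B) : plonka_sum canonical_system :=
  @Tagged _ (loc x) (@fibre B) (in_fibre x).

Definition of_plonka (u : plonka_sum canonical_system) : B := 
  val (tagged u : fibre (tag u)).

Lemma to_plonkaK : cancel to_plonka of_plonka. Proof. by []. Qed.
Lemma of_plonkaK : cancel of_plonka to_plonka.
Proof.
case=> i [x xi]; rewrite /to_plonka /of_plonka /=.
have e := eqP xi; case: i / e xi => xi.
by congr (Tagged _ _); apply: val_inj.
Qed.

Lemma plonka_representation :
  [/\ bijective to_plonka,
      forall x y, to_plonka (x \wedge y) =
        plonka_meet (to_plonka x) (to_plonka y),
      forall x y, to_plonka (x \vee y) =
        plonka_join (to_plonka x) (to_plonka y),
      forall x, to_plonka (ineg x) = plonka_neg (to_plonka x)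
    & to_plonka izero = plonka_zero canonical_system /\
      to_plonka ione = plonka_one canonical_system].
Proof.
have J (x y : B) : x \vee (iloc x \vee iloc y) \vee (y \vee (iloc x \vee iloc y))
    = x \vee y.
  rewrite [in y \vee _](ijoinC (iloc x)) !(ijoinA _ (iloc _)) !ijoin_loc.
  by rewrite ijoinA (ijoinAC x) -(ijoinA x) ijoin_loc ijoinAC ijoin_loc.
split; first by exists of_plonka; [exact: to_plonkaK|exact: of_plonkaK].
- move=> x y; apply: (can_inj of_plonkaK); rewrite /of_plonka /=.
  rewrite -imeet_shift ?ijoinA ?ijoinxx //.
  + by rewrite -!ijoinA -ilocIU ijoin_loc.
  + by rewrite ilocUU !ilocK.
  + by rewrite ijoinAC ijoinxx ijoinC.
- move=> x y; apply: (can_inj of_plonkaK); rewrite /of_plonka /=.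
  by rewrite J.
- by move=> x; apply: (can_inj of_plonkaK).
- by split; apply: (can_inj of_plonkaK); rewrite /of_plonka //= ineg0.
Qed.

End CanonicalSystem.

Definition injective_ibsl (B : ibslType) : Prop :=
  injective_system (canonical_system B).

Section Booleanisation.
Variable B : ibslType.
Implicit Types x y z : B.

Definition sim x y : Prop :=
  exists (k : ib_index B) (xk : (loc x <= k)%O) (yk : (loc y <= k)%O),
    fibre_map xk (in_fibre x) = fibre_map yk (in_fibre y).

Lemma simP x y : sim x y <-> exists2 q, iloc q = q & x \vee q = y \vee q.
Proof.
split=> [[k [xk [yk /(congr1 val)/= e]]]|[q hq e]].
  by exists (val k) => //; exact: indexP.
have hk : iloc (q \vee (iloc x \vee iloc y)) == q \vee (iloc x \vee iloc y).
  by rewrite !ilocUU !ilocK hq.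
pose k : ib_index B := Index hk.
have xk : (loc x <= k)%O.
  by apply/index_leP; rewrite /= (ijoinC q) !ijoinA ijoinxx.
have yk : (loc y <= k)%O.
  by apply/index_leP; rewrite /= (ijoinC q) (ijoinC (iloc x)) !ijoinA ijoinxx.
exists k, xk, yk; apply: val_inj => /=.
by rewrite !ijoinA e.
Qed.

Definition simb x y : bool := `[< sim x y >].

Fact simb_refl : reflexive simb.
Proof. by move=> x; apply/asboolP/simP; exists izero; rewrite // (eqP (index_botP B)). Qed.
Fact simb_sym : symmetric simb.
Proof.
by move=> x y; apply/asboolP/asboolP => /simP[q hq e]; apply/simP; exists q.
Qed.
Fact simb_trans : transitive simb.
Proof.
move=> y x z /asboolP/simP[p hp xy] /asboolP/simP[q hq yz].
apply/asboolP/simP; exists (p \vee q); first by rewrite ilocUU hp hq.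
by rewrite ijoinA xy ijoinAC yz -!ijoinA (ijoinC p).
Qed.

Canonical simb_equiv := EquivRel simb simb_refl simb_sym simb_trans.

Definition booleanisation := {eq_quot simb_equiv}%qT.

HB.instance Definition _ := Choice.on booleanisation.
HB.instance Definition _ := EqQuotient.on booleanisation.

Definition bclass x : booleanisation := (\pi_booleanisation x)%qT.

Lemma bclassP x y : bclass x = bclass y <-> sim x y.
Proof.
split=> [/eqquotP/asboolP //|h].
by apply/eqquotP; apply/asboolP.
Qed.

Lemma bclass_surj (X : booleanisation) : exists x, bclass x = X.
Proof. by exists (repr X); exact: reprK. Qed.

Lemma sim_repr x : sim (repr (bclass x)) x.
Proof. by apply/bclassP; exact: reprK. Qed.

Lemma sim_refl x : sim x x. Proof. exact/asboolP/simb_refl. Qed.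

Lemma sim_join x x' y y' : sim x x' -> sim y y' -> sim (x \vee y) (x' \vee y').
Proof.
move=> /simP[p hp xy] /simP[q hq yz]; apply/simP.
exists (p \vee q); first by rewrite ilocUU hp hq.
by rewrite ijoinACA xy yz -ijoinACA.
Qed.

Lemma upper_index x y p : iloc p = p -> exists q, [/\ iloc q = q,
  p \vee q = q, iloc x \vee q = q & iloc y \vee q = q].
Proof.
move=> hp; exists (p \vee (iloc x \vee iloc y)); split.
- by rewrite !ilocUU !ilocK hp.
- by rewrite !ijoinA ijoinxx.
- by rewrite (ijoinC p) !ijoinA ijoinxx.
- by rewrite (ijoinC p) (ijoinC (iloc x)) !ijoinA ijoinxx.
Qed.

Lemma sim_neg x x' : sim x x' -> sim (ineg x) (ineg x').
Proof.
move=> /simP[p hp e]; have [q [hq pq xq x'q]] := upper_index x x' hp.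
apply/simP; exists q => //.
by rewrite -!ineg_shift // -pq !ijoinA e.
Qed.

Lemma sim_meet x x' y y' :
  sim x x' -> sim y y' -> sim (x \wedge y) (x' \wedge y').
Proof.
by move=> h k; rewrite !imeetE; apply/sim_neg/sim_join; apply: sim_neg.
Qed.

Definition bmeet (X Y : booleanisation) := bclass (repr X \wedge repr Y).
Definition bjoin (X Y : booleanisation) := bclass (repr X \vee repr Y).
Definition bcompl (X : booleanisation) := bclass (ineg (repr X)).
Definition bbot := bclass izero.
Definition btop := bclass ione.

Lemma bmeetE x y : bmeet (bclass x) (bclass y) = bclass (x \wedge y).
Proof. by apply/bclassP/sim_meet; exact: sim_repr. Qed.
Lemma bjoinE x y : bjoin (bclass x) (bclass y) = bclass (x \vee y).
Proof. by apply/bclassP/sim_join; exact: sim_repr. Qed.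
Lemma bcomplE x : bcompl (bclass x) = bclass (ineg x).
Proof. by apply/bclassP/sim_neg; exact: sim_repr. Qed.

Fact bmeetC : commutative bmeet.
Proof. by move=> X Y; rewrite /bmeet imeetC. Qed.
Fact bjoinC : commutative bjoin.
Proof. by move=> X Y; rewrite /bjoin ijoinC. Qed.
Fact bmeetA : associative bmeet.
Proof.
move=> X Y Z; have [[x <-] [y <-] [z <-]] := And3 (bclass_surj X) (bclass_surj Y) (bclass_surj Z).
by rewrite !bmeetE imeetA.
Qed.
Fact bjoinA : associative bjoin.
Proof.
move=> X Y Z; have [[x <-] [y <-] [z <-]] := And3 (bclass_surj X) (bclass_surj Y) (bclass_surj Z).
by rewrite !bjoinE ijoinA.
Qed.
Fact bjoinKI Y X : bmeet X (bjoin X Y) = X.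
Proof.
have [[x <-] [y <-]] := conj (bclass_surj X) (bclass_surj Y).
rewrite bjoinE bmeetE; apply/bclassP/simP.
have [q [hq _ xq yq]] := upper_index x y (eqP (index_botP B)).
exists q => //; rewrite imeet_shift //; last by rewrite ilocUU -ijoinA yq.
have -> : x \vee y \vee q = (x \vee q) \vee (y \vee q).
  by rewrite ijoinA (ijoinAC x q) -[RHS]ijoinA ijoinxx.
by rewrite imeetKU_loc // !iloc_shift // xq yq.
Qed.
Fact bmeetKU Y X : bjoin X (bmeet X Y) = X.
Proof.
have [[x <-] [y <-]] := conj (bclass_surj X) (bclass_surj Y).
rewrite bmeetE bjoinE; apply/bclassP/simP.
have [q [hq _ xq yq]] := upper_index x y (eqP (index_botP B)).
exists q => //.
have -> : x \vee (x \wedge y) \vee q = (x \vee q) \vee ((x \wedge y) \vee q).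
  by rewrite ijoinA (ijoinAC x q) -[RHS]ijoinA ijoinxx.
by rewrite imeet_shift // ijoinKI_loc // !iloc_shift // xq yq.
Qed.
Fact bmeetUl : left_distributive bmeet bjoin.
Proof.
move=> X Y Z; rewrite !(bmeetC _ Z).
have [[x <-] [y <-] [z <-]] := And3 (bclass_surj X) (bclass_surj Y) (bclass_surj Z).
rewrite bjoinE !bmeetE bjoinE; apply/bclassP/simP.
have [p [hp _ xp yp]] := upper_index x y (eqP (index_botP B)).
have [q [hq pq zq _]] := upper_index z z hp.
have xq : iloc x \vee q = q by rewrite -pq ijoinA xp.
have yq : iloc y \vee q = q by rewrite -pq ijoinA yp.
have D u v : u \vee v \vee q = (u \vee q) \vee (v \vee q).
  by rewrite ijoinA (ijoinAC u q) -[RHS]ijoinA ijoinxx.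
have xyq : iloc (x \vee y) \vee q = q by rewrite ilocUU -ijoinA yq.
have lE u : iloc u \vee q = q -> iloc (u \vee q) = q by rewrite iloc_shift.
exists q; first exact: hq.
rewrite (D (z \wedge x)) (imeet_shift hq zq xq) (imeet_shift hq zq yq).
rewrite (imeet_shift hq zq xyq) (D x y).
by apply: imeetUl_loc; rewrite !lE.
Qed.
Fact bmeetxx : idempotent_op bmeet.
Proof. by move=> X; have [x <-] := bclass_surj X; rewrite bmeetE imeetxx. Qed.

HB.instance Definition _ := Order.isMeetJoinDistrLattice.Build
  bool_display booleanisation (fun _ _ => erefl) (fun _ _ => erefl)
  bmeetC bjoinC bmeetA bjoinA bjoinKI bmeetKU bmeetUl bmeetxx.

Lemma bclass_bot x : iloc x = x -> bclass x = bbot.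
Proof.
move=> h; apply/bclassP/simP; exists x => //.
by rewrite ijoin0x ijoinxx.
Qed.

Fact ble0x X : (bbot <= X)%O.
Proof.
have [x <-] := bclass_surj X; apply/eqP; rewrite [LHS]bmeetE.
by apply: bclass_bot; rewrite imeetC -iloc0 ilocK.
Qed.
Fact blex1 X : (X <= btop)%O.
Proof.
have [x <-] := bclass_surj X; apply/eqP; rewrite [LHS]bmeetE.
by rewrite imeetC imeet1x.
Qed.

HB.instance Definition _ := Order.hasBottom.Build bool_display booleanisation ble0x.
HB.instance Definition _ := Order.hasTop.Build bool_display booleanisation blex1.

Fact bmeetxC (X : booleanisation) : (X `&` bcompl X)%O = \bot%O.
Proof.
have [x <-] := bclass_surj X; rewrite bcomplE [LHS]bmeetE.
by apply: bclass_bot; exact: ilocK.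
Qed.
Fact bjoinxC (X : booleanisation) : (X `|` bcompl X)%O = \top%O.
Proof.
have [x <-] := bclass_surj X; rewrite bcomplE [LHS]bjoinE.
by rewrite -ineg_loc -bcomplE (bclass_bot (ilocK x)) bcomplE ineg0.
Qed.

HB.instance Definition _ := Order.TBDistrLattice_hasComplement.Build
  bool_display booleanisation bjoinxC bmeetxC.

Lemma bclassI x y : bclass (x \wedge y) = (bclass x `&` bclass y)%O.
Proof. by rewrite -bmeetE. Qed.
Lemma bclassU x y : bclass (x \vee y) = (bclass x `|` bclass y)%O.
Proof. by rewrite -bjoinE. Qed.
Lemma bclassN x : bclass (ineg x) = (~` bclass x)%O.
Proof. by rewrite -bcomplE. Qed.
Lemma bclass0 : bclass izero = \bot%O. Proof. by []. Qed.
Lemma bclass1 : bclass ione = \top%O. Proof. by []. Qed.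

End Booleanisation.

Local Open Scope ring_scope.

Definition bottoms (B : ibslType) : set B :=
  range (fun i : ib_index B => val (\bot%O : fibre i)).
Arguments bottoms : clear implicits.

Record state (R : realType) (B : ibslType) := State {
  state_fun :> B -> R;
  state_ge0 : forall a, 0 <= state_fun a;
  state_le1 : forall a, state_fun a <= 1;
  state1 : state_fun ione = 1;
  stateD : forall a b, bottoms B (a \wedge b) ->
    state_fun (a \vee b) = state_fun a + state_fun b
}.

Definition faithful (R : realType) (B : ibslType) (s : state R B) : Prop :=
  forall a, ~ bottoms B a -> 0 < s a.

Record fapm (R : realType) d (A : ctbDistrLatticeType d) := Fapm {
  fapm_fun :> A -> R;
  fapm_ge0 : forall a, 0 <= fapm_fun a;
  fapm_le1 : forall a, fapm_fun a <= 1;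
  fapm1 : fapm_fun \top%O = 1;
  fapmD : forall a b, (a `&` b)%O = \bot%O ->
    fapm_fun (a `|` b)%O = fapm_fun a + fapm_fun b
}.

Definition regular (R : realType) d (A : ctbDistrLatticeType d)
  (m : fapm R A) : Prop := forall a, a <> \bot%O -> 0 < m a.

Section Phi.
Variables (R : realType) (B : ibslType).
Implicit Types (s : state R B) (a b q : B).

Lemma bottomsP a : bottoms B a <-> iloc a = a.
Proof.
split=> [[i _ <-]|h]; first exact: indexP.
by exists (loc a).
Qed.

Lemma state_bottom s q : iloc q = q -> s q = 0.
Proof.
move=> h; have := @stateD _ _ s q q.
rewrite imeetxx ijoinxx bottomsP => /(_ h).
by rewrite -[X in X = _]addr0 => /addrI.
Qed.

Lemma state_shift s a q : iloc q = q -> iloc a \vee q = q -> s (a \vee q) = s a.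
Proof.
move=> hq aq; rewrite stateD ?(state_bottom s hq) ?addr0 //.
suff -> : a \wedge q = q by exact/bottomsP.
by rewrite -{1}hq iloc0 (imeetC q) imeetA -iloc0 -locU_I ?ilocK.
Qed.

Lemma state_sim s a b : sim a b -> s a = s b.
Proof.
move=> /simP[p hp e]; have [q [hq pq aq bq]] := upper_index a b hp.
by rewrite -(state_shift s hq aq) -(state_shift s hq bq) -pq !ijoinA e.
Qed.

Definition Phi_fun s (X : booleanisation B) : R := s (repr X).

Lemma Phi_funE s b : Phi_fun s (bclass b) = s b.
Proof. exact/state_sim/sim_repr. Qed.

Fact Phi1 s : Phi_fun s \top%O = 1.
Proof. by rewrite -bclass1 Phi_funE state1. Qed.

Fact PhiD s X Y : (X `&` Y)%O = \bot%O ->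
  Phi_fun s (X `|` Y)%O = Phi_fun s X + Phi_fun s Y.
Proof.
have [[a <-] [b <-]] := conj (bclass_surj X) (bclass_surj Y).
rewrite -bclassI -bclassU -bclass0 bclassP !Phi_funE => /simP[p hp e].
have [q [hq pq aq bq]] := upper_index a b hp.
have abq : iloc (a \vee b) \vee q = q by rewrite ilocUU -ijoinA bq.
rewrite -(state_shift s hq aq) -(state_shift s hq bq) -(state_shift s hq abq).
rewrite -stateD; last first.
  by rewrite -imeet_shift // -pq ijoinA e ijoin0x pq; apply/bottomsP.
by rewrite ijoinA (ijoinAC a q) -[in RHS]ijoinA ijoinxx.
Qed.

(* The value at a class is read off a representative; by PhiE below the
   choice is immaterial. *)
Definition Phi s : fapm R (booleanisation B) :=
  @Fapm R _ (booleanisation B) (Phi_fun s) (fun X => state_ge0 s (repr X))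
    (fun X => state_le1 s (repr X)) (Phi1 s) (@PhiD s).

Lemma PhiE s b : Phi s (bclass b) = s b.
Proof. exact: Phi_funE. Qed.

End Phi.

(* Main.v *)
Require Import Defs.
From mathcomp Require Import all_boot all_order all_algebra.
From mathcomp Require Import boolp classical_sets functions reals.

Local Open Scope classical_set_scope.

(** Since [Phi s] composed with the quotient map is [s], every finitely additive
    probability measure [m] on the Booleanisation is [Phi] of the state
    [m \o bclass], and [Phi] is injective.  Injectivity of the system is what
    makes faithful and regular correspond: it forces an element whose class is
    zero in the direct limit to be the bottom of its own summand already. *)

Lemma state_ext (R : realType) (B : ibslType) (s t : state R B) :
  s =1 t -> s = t.
Proof.
case: s => f f0 f1 fI fU; case: t => g g0 g1 gI gU /= /funext fg.
by move: f0 f1 fI fU; rewrite fg => *; congr State; exact: Prop_irrelevance.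
Qed.

Lemma fapm_ext (R : realType) d (A : ctbDistrLatticeType d) (m n : fapm R A) :
  m =1 n -> m = n.
Proof.
case: m => f f0 f1 fI fU; case: n => g g0 g1 gI gU /= /funext fg.
by move: f0 f1 fI fU; rewrite fg => *; congr Fapm; exact: Prop_irrelevance.
Qed.

Lemma bclass_eq_bot {B : ibslType} (hB : injective_ibsl B) (a : B) :
  bclass a = \bot%O <-> bottoms B a.
Proof.
rewrite bottomsP; split; last exact: bclass_bot.
rewrite -bclass0 bclassP => /simP[q hq]; rewrite ijoin0x => aq.
(* Applying [iloc] to [aq] shows that [q], the bottom of its summand, has an index above that of
   [a]. *)
have lq : ijoin (iloc a) q = q by rewrite -[LHS]iloc_shift // aq.
pose k : ib_index B := Index (introT eqP hq).
have ak : (loc a <= k)%O by apply/index_leP.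
(* Both sides are the bottom [q] of the summand at [k], so injectivity can be used at [ak]. *)
have : fibre_map ak (in_fibre a) = fibre_map ak \bot%O.
  by apply: val_inj; rewrite /= aq lq.
by move=> /(hB _ _ ak) /(congr1 val).
Qed.

Section StateOfMeasure.
Variables (R : realType) (B : ibslType) (m : fapm R (booleanisation B)).

Fact measure_state1 : m (bclass ione) = 1%R.
Proof. by rewrite bclass1 fapm1. Qed.

(** [bclass] preserves joins and meets and collapses all local bottoms to [\bot], so additivity of
    [m] applies. *)
Fact measure_stateD (a b : B) : bottoms B (imeet a b) ->
  m (bclass (ijoin a b)) = (m (bclass a) + m (bclass b))%R.
Proof.
by move=> /bottomsP ab; rewrite bclassU fapmD // -bclassI; exact: bclass_bot.
Qed.

Definition measure_state : state R B :=
  @State R B (fun b => m (bclass b)) (fun b => fapm_ge0 m (bclass b))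
    (fun b => fapm_le1 m (bclass b)) measure_state1 measure_stateD.

Lemma measure_stateK : Phi measure_state = m.
Proof. by apply: fapm_ext => X; have [b <-] := bclass_surj X; exact: PhiE. Qed.

End StateOfMeasure.

Lemma Phi_inj (R : realType) (B : ibslType) : injective (@Phi R B).
Proof. by move=> s t st; apply: state_ext => b; rewrite -!PhiE st. Qed.

(** The nonzero classes are exactly those of non-bottom elements, and [Phi s] takes there the values
    of [s]. *)
Lemma regular_Phi {R : realType} {B : ibslType} (hB : injective_ibsl B)
    (s : state R B) : regular (Phi s) <-> faithful s.
Proof.
split=> [reg b nb|faith X].
  by rewrite -PhiE; apply: reg; rewrite (bclass_eq_bot hB).
by have [b <-] := bclass_surj X; rewrite (bclass_eq_bot hB) PhiE; exact: faith.
Qed.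

Theorem theorem4p4 (R : realType) (B : ibslType) (hB : injective_ibsl B) :
  set_bij [set s : state R B | faithful s]
          [set m : fapm R (booleanisation B) | regular m]
          (@Phi R B).
Proof.
split=> [s|s t _ _|m /= reg]; first by move/(regular_Phi hB).
  exact: Phi_inj.
exists (measure_state _ _ m); last exact: measure_stateK.
by apply/(regular_Phi hB); rewrite measure_stateK.
Qed.
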